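(* Let $q\ge2$, $m=1$, $\alpha=2$, and suppose that $ML=\mathrm{diag}(M_1L_1,M_2L_2)$ is rational in the sense that there is a constant $c>0$ such that $c\,M_1L_1$ and $c^2M_2L_2$ are both integer matrices. Then the bound $\mathcal P_{q,1}^{2,M}(R)\lesssim R^{-2}$ ($R\ge10$) is best possible, i.e. it is not true that $\mathcal P_{q,1}^{2,M}(R)=o(R^{-2})$ as $R\to\infty$.
   Context: Let $q\ge2$, $m\ge1$ be integers. $\mathbb G(q,m)$ denotes a (non-abelian) step-two nilpotent Lie group realized as $\mathbb R^q\times\mathbb R^m$ with group law $(x,t)\circ(x',t')=(x+x',\,t+t'+\frac12\langle\mathbb Ux,x'\rangle)$, where $\langle\mathbb Ux,x'\rangle:=(\langle U^{(1)}x,x'\rangle,\dots,\langle U^{(m)}x,x'\rangle)$, the $U^{(j)}$ are real $q\times q$ matrices (not all symmetric), and $\langle\cdot,\cdot\rangle$ is the Euclidean inner product. Its Haar measure $\mathrm{vol}$ is Lebesgue measure on $\mathbb R^{q+m}$. Put $Q:=q+2m$. For $\alpha>0$ and $M=\mathrm{diag}(M_1,M_2)$ with $M_1,M_2$ real invertible matrices of order $q$ and $m$, let $\mathcal N_{\alpha,M}(x,t)=(|M_1x|^\alpha+|M_2t|^{\alpha/2})^{1/\alpha}$ and $B_R^{\alpha,M}=\{(x,t):\mathcal N_{\alpha,M}(x,t)\le R\}$. Let $L=\mathrm{diag}(L_1,L_2)$ with $L_1,L_2$ real invertible matrices of order $q$ and $m$ such that $\Gamma_L:=L\mathbb Z^{q+m}=\{(L_1k',L_2k''):(k',k'')\in\mathbb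 Z^q\times\mathbb Z^m\}$ is a subgroup (hence a lattice) of $\mathbb G(q,m)$. The relative discrepancy is $$\mathcal P_{q,m}^{\alpha,M}(R):=\frac{|\det L|}{\mathrm{vol}(B_1^{\alpha,M})R^Q}\left|\#(\Gamma_L\cap B_R^{\alpha,M})-\frac{\mathrm{vol}(B_1^{\alpha,M})R^Q}{|\det L|}\right|.$$ *)

(* Defs.v *)
From HB Require Import structures.
From mathcomp Require Import all_boot all_order all_algebra finmap.
From mathcomp Require Import all_classical all_reals all_analysis.
From mathcomp Require Import ring.

Set Implicit Arguments.
Unset Strict Implicit.
Unset Printing Implicit Defensive.

Import Order.TTheory GRing.Theory Num.Theory.
Import numFieldNormedType.Exports.

Local Open Scope classical_set_scope.
Local Open Scope ring_scope.

(* Needed for the Landau notation [f =o_ +oo g] to typecheck. *)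
Canonical pinfty_filter_on (R : realType) :=
  @FilterType R (pinfty_nbhs R) _.

Section LebesgueTuple.
Context (R : realType).
Local Notation T := (measurableTypeR R).

Definition cons_pair n (p : T * n.-tuple T) : n.+1.-tuple T :=
  [tuple of p.1 :: p.2].

(* n-dimensional Lebesgue measure on the Borel (= product) sigma-algebra of
   R^n, as an n-fold product measure; R^0 carries the unit point mass. *)
Fixpoint lebesgue_tuple n : set (n.-tuple T) -> \bar R :=
  match n with
  | 0 => \d_ [tuple]
  | n'.+1 => pushforward (lebesgue_measure \x @lebesgue_tuple n')%E
                         (@cons_pair n')
  end.

Lemma measurable_cons_pair n : measurable_fun [set: _] (@cons_pair n).
Proof. exact: measurable_cons. Qed.

Let sigma_finite_ext d (S : measurableType d) (m : {measure set S -> \bar R}) :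
  sigma_finite setT m ->
  exists m' : {sigma_finite_measure set S -> \bar R},
    (m' : set S -> \bar R) = m.
Proof.
move=> sf.
pose H1 := isSFinite.Build _ _ _ _ (sfinite_measure_sigma_finite sf).
pose H2 := isSigmaFinite.Build _ _ _ _ sf.
pose m' := HB.pack_for (sigma_finite_measure S R) (Measure.sort m) H1 H2.
by exists m'.
Qed.

Lemma lebesgue_tuple_measure n :
  exists m : {sigma_finite_measure set (n.-tuple T) -> \bar R},
    (m : set (n.-tuple T) -> \bar R) = @lebesgue_tuple n.
Proof.
elim: n => [|n [m mE]] /=.
  by apply: (@sigma_finite_ext _ _ (\d_ [tuple])); exact: sigma_finiteT.
rewrite -mE.
pose p : {measure set (n.+1.-tuple T) -> \bar R} :=
  measure_function_pushforward__canonical__measure_function_Measure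
    (lebesgue_measure \x m)%E (@measurable_cons_pair n).
apply: (@sigma_finite_ext _ _ p).
have /sigma_finiteP[F [FT ndF Foo]] := sigma_finiteT (@lebesgue_measure R).
have /sigma_finiteP[G [GT ndG Goo]] := sigma_finiteT m.
pose unc (t : n.+1.-tuple T) : T * n.-tuple T := (thead t, [tuple of behead t]).
have munc : measurable_fun setT unc.
  apply/measurable_fun_pairP; split; first exact: measurable_tnth.
  exact: measurable_behead.
have uncK (x : T * n.-tuple T) : unc (cons_pair x) = x.
  by case: x => a t; congr (_, _); apply: val_inj.
exists (fun k => unc @^-1` (F k `*` G k)).
  rewrite -preimage_bigcup; apply/esym; rewrite -subTset => t _ /=.
  have [i _ Fi] : (\bigcup_k F k) (unc t).1 by rewrite -FT.
  have [j _ Gj] : (\bigcup_k G k) (unc t).2 by rewrite -GT.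
  exists (maxn i j) => //; split.
    by move: Fi; exact/subsetPset/ndF/leq_maxl.
  by move: Gj; exact/subsetPset/ndG/leq_maxr.
move=> k; have [mF Fk] := Foo k; have [mG Gk] := Goo k; split.
  by rewrite -[X in measurable X]setTI; apply: munc => //; exact: measurableX.
rewrite /p /= /pushforward -comp_preimage (_ : unc \o _ = id); last first.
  by apply/funext => x; exact: uncK.
by rewrite preimage_id product_measure1E// lte_mul_pinfty// ge0_fin_numE.
Qed.

Lemma lebesgue_tuple_box n (A : 'I_n -> set T) :
  (forall i, measurable (A i)) ->
  lebesgue_tuple [set t : n.-tuple T | forall i, A i (tnth t i)] =
  (\prod_(i < n) lebesgue_measure (A i))%E.
Proof.
elim: n A => [|n IHn] A mA /=.
  by rewrite big_ord0 diracE mem_set// => -[].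
rewrite big_ord_recl -IHn => [|i]; last exact: mA.
have [m mE] := lebesgue_tuple_measure n; rewrite -mE /pushforward.
set B := [set t : n.-tuple T | _].
have mB : measurable B.
  have -> : B = \bigcap_(i in [set: 'I_n])
      ((@tnth n T)^~ i @^-1` A (lift ord0 i)).
    by apply/seteqP; split => t /= Bt i; [move=> _|]; exact: Bt.
  apply: fin_bigcap_measurable => // i _.
  by rewrite -[X in measurable X]setTI; exact: measurable_tnth.
rewrite -product_measure1E//; congr (_ _).
apply/seteqP; split => -[a t] /=.
  move=> At; split; first exact: (At ord0).
  by move=> i; have := At (lift ord0 i); rewrite /cons_pair tnthS.
move=> [Aa Bt] i; case: (unliftP ord0 i) => [j|] ->.
  by rewrite /cons_pair tnthS; exact: Bt.
exact: Aa.
Qed.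

End LebesgueTuple.

Section StepTwo.
Context (R : realType) (q m : nat).

Definition dotcV n (u v : 'cV[R]_n) : R := \sum_i u i 0 * v i 0.

Definition enorm n (u : 'cV[R]_n) : R := Num.sqrt (dotcV u u).

(* The carrier of G(q,m) is R^q x R^m; the alias records the matrices U so that
   the group structure below can depend on them. *)
Definition step_two (U : 'I_m -> 'M[R]_q) : Type := ('cV[R]_q * 'cV[R]_m)%type.

Section Group.
Context (U : 'I_m -> 'M[R]_q).
Local Notation G := (step_two U).

HB.instance Definition _ := Choice.on G.

Definition bracket (x y : 'cV[R]_q) : 'cV[R]_m := \col_j dotcV (U j *m x) y.

Definition step_two_mul (g h : G) : G :=
  (g.1 + h.1, g.2 + h.2 + 2^-1 *: bracket g.1 h.1).

Definition step_two_one : G := (0, 0).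

Definition step_two_inv (g : G) : G :=
  (- g.1, - g.2 + 2^-1 *: bracket g.1 g.1).

Let bracketDl x y z : bracket (x + y) z = bracket x z + bracket y z.
Proof.
apply/colP => j; rewrite !mxE /dotcV mulmxDr -big_split.
by apply: eq_bigr => i _; rewrite mxE mulrDl.
Qed.

Let bracketDr x y z : bracket x (y + z) = bracket x y + bracket x z.
Proof.
apply/colP => j; rewrite !mxE /dotcV -big_split.
by apply: eq_bigr => i _; rewrite [(y + z) i 0]mxE mulrDr.
Qed.

Let bracketNl x y : bracket (- x) y = - bracket x y.
Proof.
apply/colP => j; rewrite !mxE /dotcV mulmxN -sumrN.
by apply: eq_bigr => i _; rewrite mxE mulNr.
Qed.

Let bracketNr x y : bracket x (- y) = - bracket x y.
Proof.
apply/colP => j; rewrite !mxE /dotcV -sumrN.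
by apply: eq_bigr => i _; rewrite [(- y) i 0]mxE mulrN.
Qed.

Let bracket0l y : bracket 0 y = 0.
Proof. by rewrite -[X in bracket X](subrr (0 : 'cV_q)) bracketDl bracketNl subrr. Qed.

Let bracket0r x : bracket x 0 = 0.
Proof. by rewrite -[X in bracket _ X](subrr (0 : 'cV_q)) bracketDr bracketNr subrr. Qed.

Let mulA : associative step_two_mul.
Proof.
move=> [x t] [y s] [z u]; congr (_, _); rewrite /= ?addrA//.
rewrite bracketDl bracketDr !scalerDr !addrA; apply/colP => j; rewrite !mxE.
by ring.
Qed.

Let mul1 : left_id step_two_one step_two_mul.
Proof.
by move=> [x t]; congr (_, _); rewrite /= ?bracket0l ?scaler0 ?add0r ?addr0.
Qed.

Let mulr1 : right_id step_two_one step_two_mul.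
Proof.
by move=> [x t]; congr (_, _); rewrite /= ?bracket0r ?scaler0 ?addr0.
Qed.

Let mulV : left_inverse step_two_one step_two_inv step_two_mul.
Proof.
move=> [x t]; congr (_, _); rewrite /= ?addNr// bracketNl.
by apply/colP => j; rewrite !mxE; ring.
Qed.

Let mulrV : right_inverse step_two_one step_two_inv step_two_mul.
Proof.
move=> [x t]; congr (_, _); rewrite /= ?subrr// bracketNr.
by apply/colP => j; rewrite !mxE; ring.
Qed.

HB.instance Definition _ := isGroup.Build G mulA mul1 mulr1 mulV mulrV.

End Group.

Definition homnorm (alpha : R) (M1 : 'M[R]_q) (M2 : 'M[R]_m)
    (g : 'cV[R]_q * 'cV[R]_m) : R :=
  (enorm (M1 *m g.1) `^ alpha + enorm (M2 *m g.2) `^ (alpha / 2)) `^ alpha^-1.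

Definition homball alpha M1 M2 (r : R) : set ('cV[R]_q * 'cV[R]_m) :=
  [set g | homnorm alpha M1 M2 g <= r].

Definition vol (A : set ('cV[R]_q * 'cV[R]_m)) : \bar R :=
  lebesgue_tuple [set t : (q + m).-tuple (measurableTypeR R) |
    A (\col_i tnth t (lshift m i), \col_j tnth t (rshift q j))].

(* Gamma_L = L Z^(q+m) for L = diag(L1, L2) *)
Definition lattice (L1 : 'M[R]_q) (L2 : 'M[R]_m) :
    set ('cV[R]_q * 'cV[R]_m) :=
  [set (L1 *m map_mx intr k.1, L2 *m map_mx intr k.2)
    | k in [set: 'cV[int]_q * 'cV[int]_m]].

(* fset_set would send an infinite set to the empty one, but here the
   intersection of a lattice with a bounded ball is finite when alpha > 0 and
   M1, M2, L1, L2 are invertible. *)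
Definition rel_discrepancy (alpha : R) (M1 : 'M[R]_q) (M2 : 'M[R]_m)
    (L1 : 'M[R]_q) (L2 : 'M[R]_m) (r : R) : R :=
  let detL := `|\det (block_mx L1 0 0 L2)| in
  let volB := fine (vol (homball alpha M1 M2 1)) * r ^+ (q + 2 * m) in
  let N := #|` fset_set (lattice L1 L2 `&` homball alpha M1 M2 r)|%fset in
  detL / volB * `|N%:R - volB / detL|.

End StepTwo.

(* Main.v *)
Require Import Defs.
From HB Require Import structures.
From mathcomp Require Import all_boot all_order all_algebra finmap.
From mathcomp Require Import all_classical all_reals all_analysis.
From mathcomp Require Import measurable_realfun ring lra.

Set Implicit Arguments.
Unset Strict Implicit.
Unset Printing Implicit Defensive.

Import Order.TTheory GRing.Theory Num.Theory.
Import numFieldNormedType.Exports.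

Local Open Scope classical_set_scope.
Local Open Scope ring_scope.

(* For alpha = 2, g lies in B_r iff |M1 g.1|^2 + |M2 g.2| <= r^2. On the lattice,
   c^2 times the left-hand side is an integer, so the number of lattice points
   in B_r does not change while (c r)^2 ranges over [n, n+1). Let (c r)^2 = n and
   (c s)^2 = n + 1/2. With a = vol(B_1) / |det L|, the main term grows by
   a (s^(q+2) - r^(q+2)) >= a s^q / (2 c^2), so the relative discrepancies at r
   and s cannot be below r^-2 / (8 c^2) and s^-2 / (8 c^2) respectively. *)

(** * Comparison of the Euclidean norm with the sizes of the entries *)

Lemma dotcV_ge0 (R : realType) n (u : 'cV[R]_n) : 0 <= dotcV u u.
Proof. by apply: sumr_ge0 => i _; rewrite -expr2 sqr_ge0. Qed.

Lemma enorm_ge0 (R : realType) n (u : 'cV[R]_n) : 0 <= enorm u.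
Proof. exact: sqrtr_ge0. Qed.

Lemma ler_norm_enorm (R : realType) n (u : 'cV[R]_n) i : `|u i 0| <= enorm u.
Proof.
rewrite -sqrtr_sqr ler_wsqrtr// /dotcV (bigD1 i)//= -expr2 lerDl.
by apply: sumr_ge0 => j _; rewrite -expr2 sqr_ge0.
Qed.

Lemma enorm_le_sum (R : realType) n (u : 'cV[R]_n) :
  enorm u <= \sum_i `|u i 0|.
Proof.
have s_ge0 : 0 <= \sum_i `|u i 0| by exact: sumr_ge0.
rewrite -(ler_pXn2r (n := 2))// ?nnegrE ?enorm_ge0//.
rewrite sqr_sqrtr ?dotcV_ge0// expr2 mulr_suml; apply: ler_sum => i _.
rewrite (le_trans (ler_norm _))// normrM ler_wpM2l//.
by rewrite (bigD1 i)//= lerDl sumr_ge0.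
Qed.

(** A crude bound for the operator norm from the sup norm to the Euclidean norm; any finite constant
    serves below. *)
Definition entry_sum (R : realType) m n (A : 'M[R]_(m, n)) : R :=
  \sum_i \sum_j `|A i j|.

Lemma entry_sum_ge0 (R : realType) m n (A : 'M[R]_(m, n)) : 0 <= entry_sum A.
Proof. by apply: sumr_ge0 => i _; exact: sumr_ge0. Qed.

Lemma enorm_mulmx_le (R : realType) m n (A : 'M[R]_(m, n)) (u : 'cV[R]_n) b :
  (forall i, `|u i 0| <= b) -> enorm (A *m u) <= entry_sum A * b.
Proof.
move=> ub; rewrite (le_trans (enorm_le_sum _))// mulr_suml ler_sum// => i _.
rewrite mxE (le_trans (ler_norm_sum _ _ _))// mulr_suml ler_sum// => j _.
by rewrite normrM ler_wpM2l.
Qed.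

Lemma norm_le_enorm_mulmx (R : realType) n (A : 'M[R]_n) (u : 'cV[R]_n) b :
  A \in unitmx -> enorm (A *m u) <= b ->
  forall i, `|u i 0| <= entry_sum (invmx A) * b.
Proof.
move=> Au Aub i; rewrite (le_trans (ler_norm_enorm _ _))//.
rewrite -{1}[u](mulKmx Au); apply: enorm_mulmx_le => j.
exact: le_trans (ler_norm_enorm _ _) Aub.
Qed.

(** * Measurability of the balls, and positive finite volume of the unit ball *)

Section HomballVolume.
Context (R : realType) (q m : nat).
Local Notation T := (measurableTypeR R).

(** The index map [f] lets one lemma serve both blocks of coordinates, through [lshift] and
    [rshift]. *)
Lemma measurable_enorm_mulmx n k (A : 'M[R]_n) (f : 'I_n -> 'I_k) :
  measurable_fun [set: k.-tuple T]
    (fun t => enorm (A *m \col_i tnth t (f i))).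
Proof.
under eq_fun => t do rewrite /enorm -powR12_sqrt ?dotcV_ge0//.
apply: (measurableT_comp (measurable_powR _)).
apply: measurable_sum => i.
have mAi : measurable_fun [set: k.-tuple T]
    (fun t => (A *m \col_i tnth t (f i)) i 0).
  under eq_fun => t do rewrite mxE.
  apply: measurable_sum => j; apply: measurable_funM => //.
  under eq_fun => t do rewrite mxE.
  exact: measurable_tnth.
exact: measurable_funM.
Qed.

Lemma measurable_homball (alpha : R) (M1 : 'M[R]_q) (M2 : 'M[R]_m) r :
  measurable [set t : (q + m).-tuple T |
    homball alpha M1 M2 r
      (\col_i tnth t (lshift m i), \col_j tnth t (rshift q j))].
Proof.
rewrite -[X in measurable X]setTI; apply: measurable_fun_le => //.
rewrite /homnorm; apply: (measurableT_comp (measurable_powR _)).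
apply: measurable_funD => /=.
  by apply: (measurableT_comp (measurable_powR _)); exact: measurable_enorm_mulmx.
by apply: (measurableT_comp (measurable_powR _)); exact: measurable_enorm_mulmx.
Qed.

Definition cube n (e : R) : set (n.-tuple T) :=
  [set t | forall i, `|tnth t i| <= e].
Arguments cube : clear implicits.

Lemma cubeE n e :
  cube n e = [set t | forall i, (`[- e, e]%classic : set T) (tnth t i)].
Proof.
by apply/seteqP; split => t te i /=; have := te i;
   rewrite /= in_itv/= ler_norml.
Qed.

Lemma measurable_cube n e : measurable (cube n e).
Proof.
have -> : cube n e = \bigcap_(i in [set: 'I_n])
    ((@tnth n T)^~ i @^-1` (`[- e, e]%classic : set T)).
  by rewrite cubeE; apply/seteqP; split => t /= te i; [move=> _|]; exact: te.
apply: fin_bigcap_measurable => // i _.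
by rewrite -[X in measurable X]setTI; exact: measurable_tnth.
Qed.

Lemma lebesgue_tuple_cube n e : 0 < e ->
  lebesgue_tuple (cube n e) = ((2 * e) ^+ n)%:E.
Proof.
move=> e0; rewrite cubeE (@lebesgue_tuple_box _ _ (fun=> _))//.
rewrite lebesgue_measure_itv/= lte_fin gtrN// -EFinD opprK -mulr2n mulr_natl.
by rewrite prodEFin big_const iter_mulr_1 card_ord.
Qed.

(** [lebesgue_tuple] is a bare set function, so monotonicity comes from the measure that it
    equals. *)
Lemma le_lebesgue_tuple n (A B : set (n.-tuple T)) :
  measurable A -> measurable B -> A `<=` B ->
  (lebesgue_tuple A <= lebesgue_tuple B)%E.
Proof.
have [mu <-] := lebesgue_tuple_measure R n => mA mB AB.
by apply: le_measure; rewrite ?inE.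
Qed.

Section Homball1.
Context (alpha : R) (M1 : 'M[R]_q) (M2 : 'M[R]_m) (alpha_gt0 : 0 < alpha).

Let one_powR p : 1 `^ p = 1 :> R. Proof. by rewrite powR1. Qed.

Lemma homball1P g : homball alpha M1 M2 1 g <->
  enorm (M1 *m g.1) `^ alpha + enorm (M2 *m g.2) `^ (alpha / 2) <= 1.
Proof.
rewrite /homball /homnorm /=; set s := _ + _.
have s0 : 0 <= s by rewrite addr_ge0 ?powR_ge0.
have a0 := ltW alpha_gt0; split => [s1|s1].
  rewrite -[s]powRr1// -[X in _ `^ X](mulVf (lt0r_neq0 alpha_gt0)) powRrM.
  rewrite -[leRHS](one_powR alpha); apply: ge0_ler_powR => //; rewrite nnegrE//.
  exact: powR_ge0.
rewrite -[leRHS](one_powR alpha^-1).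
by apply: ge0_ler_powR; rewrite ?nnegrE ?invr_ge0.
Qed.

(** Two nonnegative powers with sum at most 1 force both norms to be at most 1; inverting [M1] and
    [M2] then bounds the entries. *)
Lemma homball1_sub_cube : M1 \in unitmx -> M2 \in unitmx ->
  exists2 K : R, 0 < K & forall g, homball alpha M1 M2 1 g ->
    (forall i, `|g.1 i 0| <= K) /\ (forall i, `|g.2 i 0| <= K).
Proof.
move=> M1u M2u.
have powR_le1 (x b : R) : 0 <= x -> 0 < b -> x `^ b <= 1 -> x <= 1.
  move=> x0 b0; apply: contraTT; rewrite -!ltNge => x1.
  by rewrite -[ltLHS](one_powR b); apply: gt0_ltr_powR; rewrite ?nnegrE.
have K1 := entry_sum_ge0 (invmx M1); have K2 := entry_sum_ge0 (invmx M2).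
(* The [+ 1] keeps the bound positive even if both entry sums vanish. *)
exists (entry_sum (invmx M1) + entry_sum (invmx M2) + 1); first by lra.
move=> g /homball1P gB; split => i.
  have g1 : enorm (M1 *m g.1) <= 1.
    apply: (powR_le1 _ alpha); rewrite ?enorm_ge0// (le_trans _ gB)//.
    by rewrite lerDl powR_ge0.
  by have := norm_le_enorm_mulmx M1u g1 i; lra.
have g2 : enorm (M2 *m g.2) <= 1.
  apply: (powR_le1 _ (alpha / 2)); rewrite ?enorm_ge0 ?divr_gt0//.
  by rewrite (le_trans _ gB)// lerDr powR_ge0.
by have := norm_le_enorm_mulmx M2u g2 i; lra.
Qed.

Lemma cube_sub_homball1 : exists2 e : R, 0 < e & forall g : 'cV[R]_q * 'cV[R]_m,
  (forall i, `|g.1 i 0| <= e) -> (forall i, `|g.2 i 0| <= e) ->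
  homball alpha M1 M2 1 g.
Proof.
(* [d ^ alpha + d ^ (alpha / 2) = 1/4 + 1/2 <= 1] *)
pose d : R := 2^-1 `^ (2 / alpha).
have d0 : 0 < d by rewrite powR_gt0.
have d1 : d `^ alpha = 4^-1.
  by rewrite -powRrM divfK ?gt_eqF// powR_mulrn; lra.
have d2 : d `^ (alpha / 2) = 2^-1.
  by rewrite -powRrM mulrA divfK ?gt_eqF// divff// powRr1.
have K1 := entry_sum_ge0 M1; have K2 := entry_sum_ge0 M2.
(* [k] dominates both entry sums, so entries of size at most [d / k] give norms at most [d]. *)
set k := entry_sum M1 + entry_sum M2 + 1.
have k0 : 0 < k by rewrite /k; lra.
exists (d / k) => [|g g1 g2]; first by rewrite divr_gt0.
have dk : 0 <= d / k by rewrite divr_ge0 ?ltW.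
have dE : k * (d / k) = d by rewrite mulrC divfK ?gt_eqF.
have e1 : enorm (M1 *m g.1) <= d.
  by rewrite (le_trans (enorm_mulmx_le _ g1))// -[leRHS]dE ler_wpM2r// /k; lra.
have e2 : enorm (M2 *m g.2) <= d.
  by rewrite (le_trans (enorm_mulmx_le _ g2))// -[leRHS]dE ler_wpM2r// /k; lra.
apply/homball1P.
have powR_le (x b : R) : 0 <= x -> 0 <= b -> x <= d -> x `^ b <= d `^ b.
  by move=> x0 b0; apply: ge0_ler_powR; rewrite ?nnegrE// ltW.
have a0 := ltW alpha_gt0; have a20 : 0 <= alpha / 2 by rewrite divr_ge0.
have := powR_le _ _ (enorm_ge0 _) a0 e1; rewrite d1.
by have := powR_le _ _ (enorm_ge0 _) a20 e2; rewrite d2; lra.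
Qed.

(** The unit ball lies between two cubes of positive side. The outer one matters as much as the
    inner one, because [fine] would send an infinite volume to 0. *)
Lemma vol_homball1_gt0 : M1 \in unitmx -> M2 \in unitmx ->
  0 < fine (vol (homball alpha M1 M2 1)).
Proof.
move=> M1u M2u; have mB := measurable_homball alpha M1 M2 1.
have [K K0 ball_cube] := homball1_sub_cube M1u M2u.
have [e e0 cube_ball] := cube_sub_homball1.
apply: fine_gt0; apply/andP; split.
  rewrite (@lt_le_trans _ _ (lebesgue_tuple (cube (q + m) e)))//.
    by rewrite lebesgue_tuple_cube// lte_fin exprn_gt0 ?mulr_gt0.
  apply: le_lebesgue_tuple => //; first exact: measurable_cube.
  by move=> t te; apply: cube_ball => i; rewrite mxE.
rewrite (@le_lt_trans _ _ (lebesgue_tuple (cube (q + m) K)))//.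
  apply: le_lebesgue_tuple => //; first exact: measurable_cube.
  move=> t /ball_cube[/= t1 t2] i.
  by case: (splitP i) => j ij; [have := t1 j|have := t2 j];
    rewrite mxE; congr (`|tnth t _| <= K); apply: val_inj.
by rewrite lebesgue_tuple_cube// ltry.
Qed.

End Homball1.

End HomballVolume.

(** * Lattice points and balls for [alpha = 2] *)

Lemma homball2P (R : realType) q m (M1 : 'M[R]_q) (M2 : 'M[R]_m) r g :
  0 <= r ->
  homball 2 M1 M2 r g <->
  dotcV (M1 *m g.1) (M1 *m g.1) + enorm (M2 *m g.2) <= r ^+ 2.
Proof.
move=> r0; rewrite /homball /homnorm /= divff// powRr1 ?enorm_ge0//.
rewrite powR_mulrn ?enorm_ge0// sqr_sqrtr ?dotcV_ge0//.
rewrite powR12_sqrt ?addr_ge0 ?dotcV_ge0 ?enorm_ge0//.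
by rewrite -{1}(ger0_norm r0) -sqrtr_sqr ler_sqrt ?sqr_ge0.
Qed.

Lemma enorm_cV1 (R : realType) (u : 'cV[R]_1) : enorm u = `|u 0 0|.
Proof. by rewrite /enorm /dotcV big_ord1 -expr2 sqrtr_sqr. Qed.

(** On the lattice [c *: (M1 *m g.1)] is an integer vector, so its squared length is an integer. The
    second block is one-dimensional, so its norm is an absolute value and [c ^+ 2] makes it
    integral; in higher dimension a square root would remain. *)
Lemma lattice_sqnorm_int (R : realType) q (M1 L1 : 'M[R]_q) (M2 L2 : 'M[R]_1) c g :
  c *: (M1 *m L1) \is a mxOver Num.int ->
  c ^+ 2 *: (M2 *m L2) \is a mxOver Num.int ->
  lattice L1 L2 g ->
  c ^+ 2 * (dotcV (M1 *m g.1) (M1 *m g.1) + enorm (M2 *m g.2)) \is a Num.int.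
Proof.
move=> ML1 ML2 [k _ <-] /=.
have kint n (v : 'cV[int]_n) : map_mx intr v \is a @mxOver n 1 R Num.int.
  by apply/mxOverP => i j; rewrite mxE intr_int.
rewrite mulrDr rpredD//.
  rewrite mulr_sumr rpred_sum// => i _.
  have /mxOverP/(_ i 0) zi : c *: (M1 *m L1) *m map_mx intr k.1 \is a mxOver Num.int.
    exact: mxOverM.
  rewrite mulmxA (_ : _ * _ = (c *: (M1 *m L1) *m map_mx intr k.1) i 0 ^+ 2).
    exact: rpredX.
  by rewrite -scalemxAl [in RHS]mxE -expr2 exprMn.
have /mxOverP/(_ 0 0) z0 : c ^+ 2 *: (M2 *m L2) *m map_mx intr k.2 \is a mxOver Num.int.
  exact: mxOverM.
rewrite enorm_cV1 -[c ^+ 2]ger0_norm ?sqr_ge0// -normrM mulmxA.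
by move: z0; rewrite -scalemxAl mxE => z0; exact/intr_nat/natr_norm_int.
Qed.

(** Membership of a lattice point compares an integer with [(c * r) ^+ 2], and no integer lies
    strictly between [n] and [n.+1]. *)
Lemma lattice_homball_const (R : realType) q (M1 L1 : 'M[R]_q) (M2 L2 : 'M[R]_1)
    c r s n :
  0 < c -> c *: (M1 *m L1) \is a mxOver Num.int ->
  c ^+ 2 *: (M2 *m L2) \is a mxOver Num.int ->
  0 <= r -> 0 <= s ->
  n%:R <= (c * r) ^+ 2 < n.+1%:R -> n%:R <= (c * s) ^+ 2 < n.+1%:R ->
  lattice L1 L2 `&` homball 2 M1 M2 r = lattice L1 L2 `&` homball 2 M1 M2 s.
Proof.
move=> c0 ML1 ML2.
(* Only an upper bound on [r'] and a lower bound on [s'] enter, so exchanging the radii gives the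
   reverse inclusion. *)
have sub r' s' : 0 <= r' -> 0 <= s' ->
    (c * r') ^+ 2 < n.+1%:R -> n%:R <= (c * s') ^+ 2 ->
    lattice L1 L2 `&` homball 2 M1 M2 r' `<=` homball 2 M1 M2 s'.
  move=> r0 s0 rn ns g [Lg /(homball2P _ _ _ r0) Bg].
  apply/(homball2P _ _ _ s0).
  have c20 : 0 < c ^+ 2 by rewrite exprn_gt0.
  have /intrP[z zE] := lattice_sqnorm_int ML1 ML2 Lg.
  rewrite -(ler_pM2l c20) zE -exprMn (le_trans _ ns)//.
  move: Bg; rewrite -(ler_pM2l c20) zE -exprMn => /le_lt_trans/(_ rn).
  by rewrite !pmulrn ltr_int ler_int intS addrC ltzD1.
move=> r0 s0 /andP[nr rn] /andP[ns sn].
by apply/seteqP; split => g [Lg Bg]; split => //; apply: sub (conj Lg Bg).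
Qed.

Theorem mainTheorem2 (R : realType) (q : nat) (U : 'I_1 -> 'M[R]_q)
  (M1 L1 : 'M[R]_q) (M2 L2 : 'M[R]_1)
  (q_ge2 : (2 <= q)%N)
  (U_nonsym : exists j, (U j)^T != U j)
  (M1_unit : M1 \in unitmx) (M2_unit : M2 \in unitmx)
  (L1_unit : L1 \in unitmx) (L2_unit : L2 \in unitmx)
  (L_subgroup : group_closed (fun g : step_two U => g \in lattice L1 L2))
  (ML_rational : exists c : R, [/\ 0 < c,
     c *: (M1 *m L1) \is a mxOver Num.int &
     c ^+ 2 *: (M2 *m L2) \is a mxOver Num.int]) :
  ~ (rel_discrepancy 2 M1 M2 L1 L2 =o_ +oo (fun r : R => r ^- 2)).
Proof.
have [c [c0 ML1 ML2]] := ML_rational.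
have c20 : 0 < c ^+ 2 by rewrite exprn_gt0.
have V0 := vol_homball1_gt0 (ltr0n R 2) M1_unit M2_unit.
pose D : R := `|\det (block_mx L1 0 0 L2)|.
have D0 : 0 < D by rewrite normr_gt0 det_ublock mulf_neq0// -unitfE.
set V := fine _ in V0.
pose N r := #|` fset_set (lattice L1 L2 `&` homball 2 M1 M2 r)|%fset.
pose a := V / D; have a0 : 0 < a by rewrite divr_gt0.
move=> /eqoP/(_ (8 * c ^+ 2)^-1) [|B [_ small]].
  by rewrite invr_gt0 mulr_gt0.
(* Multiplying by [a * r ^+ (q + 2)] clears the normalisation (Q = q + 2 as m = 1) and turns
   [r ^- 2] into [a * r ^+ q]. *)
have {}small r : 0 < r -> B < r ->
    `|(N r)%:R - a * r ^+ (q + 2)| <= (8 * c ^+ 2)^-1 * (a * r ^+ q).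
  move=> r0 /small; rewrite /rel_discrepancy -/V -/D -/(N r) muln1.
  have rq0 k : 0 < r ^+ k by rewrite exprn_gt0.
  have ar0 k : 0 < a * r ^+ k by exact: mulr_gt0.
  have -> : D / (V * r ^+ (q + 2)) = (a * r ^+ (q + 2))^-1.
    by rewrite /a mulrAC invf_div.
  rewrite [V * _ / D]mulrAC -/a normrM normr_id gtr0_norm ?invr_gt0//.
  rewrite (gtr0_norm (_ : 0 < r ^- 2)) ?invr_gt0// ler_pdivrMl// => /le_trans->//.
  by rewrite exprD [a * _]mulrA [leLHS]mulrCA mulfK ?gt_eqF.
(* The maximum with 0 covers a negative [B], whose square would be misleading; the successor makes
   [n] exceed [x ^+ 2] strictly and keeps [r] positive. *)
have [n [n1 nB]] : exists n : nat, 1 <= n%:R :> R /\ c * B < Num.sqrt n%:R.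
  pose x := Num.max 0 (c * B).
  have x0 : 0 <= x by rewrite le_max lexx.
  exists (Num.truncn (x ^+ 2)).+1; split; first by rewrite ler1n.
  rewrite (@le_lt_trans _ _ x)//; first by rewrite le_max lexx orbT.
  by rewrite -{1}(ger0_norm x0) -sqrtr_sqr ltr_sqrt ?ltr0n// truncnS_gt.
pose r := Num.sqrt n%:R / c; pose s := Num.sqrt (n%:R + 2^-1) / c.
have n0 : 0 <= n%:R :> R by lra.
have cr2 : (c * r) ^+ 2 = n%:R by rewrite mulrC divfK ?gt_eqF// sqr_sqrtr.
have cs2 : (c * s) ^+ 2 = n%:R + 2^-1.
  by rewrite mulrC divfK ?gt_eqF// sqr_sqrtr//; lra.
have r0 : 0 < r by rewrite divr_gt0// sqrtr_gt0; lra.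
have s0 : 0 < s by rewrite divr_gt0// sqrtr_gt0; lra.
have rs : r <= s by rewrite ler_pM2r ?invr_gt0// ler_sqrt; lra.
have Br : B < r by rewrite ltr_pdivlMr// mulrC.
have NE : N r = N s.
  rewrite /N (lattice_homball_const (n := n) c0 ML1 ML2 (ltW r0) (ltW s0))//.
    by rewrite cr2 -natr1; lra.
  by rewrite cs2 -[n.+1%:R]natr1; lra.
have := small r r0 Br; have := small s s0 (lt_le_trans Br rs).
rewrite NE !ler_norml !exprD.
set e := _^-1; set S := s ^+ q; set P := r ^+ q.
have e0 : 0 < e by rewrite invr_gt0 mulr_gt0.
(* Trading [c] for [e] through [c ^- 2 = 8 * e] puts both main terms and both error bounds over the
   common factor [a * e]. *)
have ce : c ^+ 2 * (8 * e) = 1 by rewrite /e; field; rewrite gt_eqF.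
have -> : s ^+ 2 = 8 * e * (n%:R + 2^-1).
  by rewrite -cs2 -[LHS]mul1r -[X in X * _ = _]ce; ring.
have -> : r ^+ 2 = 8 * e * n%:R.
  by rewrite -cr2 -[LHS]mul1r -[X in X * _ = _]ce; ring.
have S0 : 0 < S by rewrite exprn_gt0.
have PS : P <= S by rewrite lerXn2r ?nnegrE ?(ltW r0) ?(ltW s0).
have ae0 : 0 < a * e by rewrite mulr_gt0.
have aeS : 0 < a * e * S by rewrite mulr_gt0.
have aeP : a * e * P <= a * e * S by rewrite ler_wpM2l// ltW.
have aePn : n%:R * (a * e * P) <= n%:R * (a * e * S) by rewrite ler_wpM2l.
(* With [X = a * e * S], the lower bound at [s] gives a count of at least [(8 * n + 3) * X], while
   the upper bound at [r], with [P <= S], gives at most [(8 * n + 1) * X]. *)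
move=> /andP[Ns _] /andP[_ Nr]; lra.
Qed.
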